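(* For any shape $S\in\mathcal C_k$ on $n$ nodes, the adjacency closure $AC(S)$ can be grown from a single node in $O(k\log n)$ time steps by a cycle-preserving growth process in the adjacency graph model.
   Context: Shapes. Grid points are integer pairs $(x,y)$; two grid points are adjacent if they are at orthogonal (Manhattan) distance $1$. A shape $S=(V,E)$ is a finite connected graph whose nodes occupy distinct grid points and whose edges join only pairs of nodes occupying adjacent points; shapes are considered up to translation, and $n=|V|$. The adjacency closure $AC(S)$ is obtained from $S$ by adding an edge between every pair of adjacent nodes that are not yet joined. Growth operations. One node, the anchor $u_0$, is stationary; other nodes move relative to it. A growth operation on a node $u$ toward an adjacent grid point $p$ either (i) if $u$ has no edge to $p$, creates a new node $u'$ at $p$ with edge $uu'$; or (ii) if $p$ is occupied by a node $v$ with $uv\in E$, creates a new node $u'$ at $p$, replaces edge $uv$ by edges $uu',u'v$, and translates by one unit, along the axis of $uv$, the part of a spanning tree rooted at $u_0$ hanging from whichever of $u,v$ is farther from $u_0$, away from the other endpoint. In one time step a set of operations is applied concurrently, each node receiving at most one operation and all operations having the same cardinal direction; the displacement of each node is the sum of the unit vectors contributed by the operations on its path to $u_0$ in a spanning tree rooted at $u_0$. The set is collision-free if no two nodes collide during these motions or end at the same point, and for every cycle and every two of its nodes the displacements accumulated along the two paths of the cycle between them are equal. Growth processes. A cycle-preserving growth process in the adjacency graph model starts from an initial shape $S_1^b=S_0$ and in each time step $t$ applies a collision-free set of growth operations to $S_t^b$ (deleting no edges), obtaining $S_t^e$, and then sets $S_{t+1}^b=AC(S_t^e)$. It grows $S$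 in $t_f$ steps if the shape after step $t_f$ is $S$. $\mathcal C_k$ is the class of shapes having a rooted spanning tree in which every root-to-leaf path has at most $k$ turns (nodes at which the path makes a right angle). *)

(* Defs.v *)
From Stdlib Require Import Relations.
From mathcomp Require Import all_boot all_order all_algebra.
Set Implicit Arguments. Unset Strict Implicit. Unset Printing Implicit Defensive.
Import Order.TTheory GRing.Theory Num.Theory.
Local Open Scope ring_scope.

Definition pt := (int * int)%type.
Definition origin : pt := (0, 0).
Definition addp (p q : pt) : pt := (p.1 + q.1, p.2 + q.2).
Definition subp (p q : pt) : pt := (p.1 - q.1, p.2 - q.2).
Definition dotp (p q : pt) : int := p.1 * q.1 + p.2 * q.2.
Definition nscale (n : nat) (p : pt) : pt := (n%:Z * p.1, n%:Z * p.2).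
Definition adj (p q : pt) : bool := `|p.1 - q.1| + `|p.2 - q.2| == 1.
Definition dirs : seq pt := [:: (1, 0); (-1, 0); (0, 1); (0, -1)].

(* A gshape is given by the grid points occupied by its nodes (nodes occupy
   distinct points, so a node is identified with its point) and its edge set,
   stored as a symmetric set of ordered pairs.  Only membership matters. *)
Record gshape := Shape { sV : seq pt; sE : seq (pt * pt) }.

Definition is_shape (S : gshape) : Prop :=
  [/\ exists p, p \in sV S,
      (forall p q, (p, q) \in sE S -> [/\ p \in sV S, q \in sV S & adj p q]),
      (forall p q, (p, q) \in sE S -> (q, p) \in sE S) &
      (forall p q, p \in sV S -> q \in sV S ->
         clos_refl_trans pt (fun a b => (a, b) \in sE S) p q)].

Definition nnodes (S : gshape) : nat := size (undup (sV S)).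

Definition same_shape (S T : gshape) : Prop :=
  (forall p, p \in sV S <-> p \in sV T) /\
  (forall p q, (p, q) \in sE S <-> (p, q) \in sE T).

Definition transl_eq (S T : gshape) : Prop :=
  exists c : pt,
    (forall p, p \in sV S <-> addp p c \in sV T) /\
    (forall p q, (p, q) \in sE S <-> (addp p c, addp q c) \in sE T).

Definition adj_closure (S : gshape) : gshape :=
  Shape (sV S) [seq pq <- [seq (p, q) | p <- sV S, q <- sV S] | adj pq.1 pq.2].

Definition single_node : gshape := Shape [:: origin] [::].

Fixpoint turns (s : seq pt) : nat :=
  match s with
  | a :: ((b :: c :: _) as t) =>
      ((dotp (subp b a) (subp c b) == 0) : nat) + turns t
  | _ => 0
  end.

(* S has a spanning tree rooted at r, given by a parent map par, in which
   every root-to-leaf path has at most k turns.  The path from a node v to the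
   root is traject par v (m.+1) where m is the (first) time r is reached. *)
Definition in_Ck (k : nat) (S : gshape) : Prop :=
  exists (r : pt) (par : pt -> pt),
    [/\ r \in sV S,
        (forall v, v \in sV S -> v != r -> par v \in sV S /\ (par v, v) \in sE S),
        (forall v, v \in sV S -> exists m, iter m par v = r) &
        (forall v, v \in sV S ->
           (forall u, u \in sV S -> u != r -> par u != v) ->
           forall m, iter m par v = r -> r \notin traject par v m ->
             (turns (traject par v m.+1) <= k)%N)].

(* Two unit-step linear motions s1 -> e1 and s2 -> e2 (time t in [0,1])
   meet at some time t = p/q in (0,1]. *)
Definition meet (s1 e1 s2 e2 : pt) : Prop :=
  exists p q : nat, (0 < p <= q)%N /\
    addp (nscale q s1) (nscale p (subp e1 s1)) =
    addp (nscale q s2) (nscale p (subp e2 s2)).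

(* One time step of the growth process applied to S, producing T (= S^e_t).
   d : the common cardinal direction;
   op x : node x receives a growth operation toward x + d;
   D : displacement of every node (relative to the stationary anchor u0).
   An edge xy is "extended" iff a type-(ii) operation acts on it; then the
   displacement jumps by y - x across it (the far side is pushed away).
   Existence of such a D with D u0 = 0 is exactly the requirement that the
   displacements accumulated along any two paths (in particular along the
   spanning tree, and along both sides of any cycle) agree. *)
Definition extended (op : pt -> bool) (d : pt) (x y : pt) : bool :=
  (op x && (y == addp x d)) || (op y && (x == addp y d)).

Definition grow_step (S T : gshape) : Prop :=
  exists (d : pt) (op : pt -> bool) (D : pt -> pt) (u0 : pt),
  let ext := extended op d in
  (* node descriptors: (x, false) = old node x, (x, true) = new node x' *)
  let valid (a : pt * bool) := a.1 \in sV S /\ (a.2 -> op a.1) in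
  let start (a : pt * bool) := a.1 in
  let fin (a : pt * bool) :=
      if a.2 then addp (addp a.1 (D a.1)) d else addp a.1 (D a.1) in
  [/\ d \in dirs, u0 \in sV S & D u0 = origin] /\
  [/\
      (forall x y, (x, y) \in sE S ->
         D y = addp (D x) (if ext x y then subp y x else origin)),
      (forall a b, valid a -> valid b -> a != b ->
         ~ meet (start a) (fin a) (start b) (fin b)),
      (forall p, p \in sV T <-> exists a, valid a /\ p = fin a) &
      (forall p q, (p, q) \in sE T <->
         [\/ exists x y, [/\ (x, y) \in sE S, ~~ ext x y,
                            p = fin (x, false) & q = fin (y, false)],
             exists x, [/\ x \in sV S, op x &
                 ((p = fin (x, false) /\ q = fin (x, true)) \/
                  (q = fin (x, false) /\ p = fin (x, true)))] |
             exists x, [/\ x \in sV S, op x, (x, addp x d) \in sE S &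
                 ((p = fin (x, true) /\ q = fin (addp x d, false)) \/
                  (q = fin (x, true) /\ p = fin (addp x d, false)))]])].

Definition full_step (S T : gshape) : Prop :=
  exists Se, grow_step S Se /\ same_shape (adj_closure Se) T.

Fixpoint grows_in (S0 : gshape) (t : nat) (T : gshape) : Prop :=
  match t with
  | 0 => same_shape S0 T
  | t'.+1 => exists M, grows_in S0 t' M /\ full_step M T
  end.

(* Main.v *)
Require Import Defs.
From mathcomp Require Import all_boot all_order all_algebra.
From mathcomp Require Import zify ring.
From Stdlib Require Import ClassicalEpsilon.
Set Implicit Arguments. Unset Strict Implicit. Unset Printing Implicit Defensive.
Import Order.TTheory GRing.Theory Num.Theory.
Local Open Scope ring_scope.

(** All intermediate configurations are adjacency closures of node sets
    contained in [S], grown in order of the number of turns on the path to the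
    root: the nodes with [i] turns form straight segments hanging from the set
    of nodes with fewer turns, and that set never moves.  Fix a direction [d]
    and a parity class of lines parallel to [d], so that segments on these lines
    are not adjacent sideways.  Nodes of these segments lying sideways next to
    the static set are created directly from it in two steps; what remains is a
    family of segments isolated from everything except along their own line,
    which therefore grow simultaneously by doubling in [O(log n)] steps. *)

(** * Translations and adjacency along a cardinal direction *)

Definition fwd (d : pt) (m : nat) (x : pt) : pt := addp x (nscale m d).
Definition bwd (d : pt) (m : nat) (x : pt) : pt := subp x (nscale m d).

Definition closed_shape (W : seq pt) : gshape := adj_closure (Shape W [::]).

Lemma pt_eq (p q : pt) : p.1 = q.1 -> p.2 = q.2 -> p = q.
Proof. by case: p q => [a b] [c e] /= -> ->. Qed.

Lemma bwd0 d x : bwd d 0 x = x.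
Proof. by apply: pt_eq => /=; lia. Qed.

Lemma fwd0 d x : fwd d 0 x = x.
Proof. by apply: pt_eq => /=; lia. Qed.

Lemma fwd1 d x : fwd d 1 x = addp x d.
Proof. by apply: pt_eq => /=; lia. Qed.

Lemma fwdD d m n x : fwd d m (fwd d n x) = fwd d (n + m) x.
Proof. by apply: pt_eq; rewrite /= PoszD; ring. Qed.

Lemma bwdD d m n x : bwd d m (bwd d n x) = bwd d (n + m) x.
Proof. by apply: pt_eq; rewrite /= PoszD; ring. Qed.

Lemma bwd_fwd d m n x : (m <= n)%N -> bwd d m (fwd d n x) = fwd d (n - m) x.
Proof. by move=> h; apply: pt_eq; rewrite /= -subzn //; ring. Qed.

Lemma fwd_bwd d m n x : (n <= m)%N -> fwd d n (bwd d m x) = bwd d (m - n) x.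
Proof. by move=> h; apply: pt_eq; rewrite /= -subzn //; ring. Qed.

Lemma dirsP (d : pt) : d \in dirs ->
  [\/ d = (1, 0), d = (-1, 0), d = (0, 1) | d = (0, -1)].
Proof.
rewrite !inE => /or4P[] /eqP ->;
  by [constructor 1|constructor 2|constructor 3|constructor 4].
Qed.

Lemma bwd_inj d x : d \in dirs -> injective (fun m => bwd d m x).
Proof. by move=> /dirsP[] -> m n [] /=; lia. Qed.

Lemma adj_cases d (x y : pt) : d \in dirs -> adj x y ->
  [\/ y = addp x d, x = addp y d | dotp (subp y x) d = 0].
Proof.
case: x y => [a b] [c e] /dirsP[] -> ; rewrite /adj /addp /subp /dotp /= => h.
- have [?|[?|?]] : c = a + 1 \/ a = c + 1 \/ c = a by lia.
  + by constructor 1; congr pair; lia.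
  + by constructor 2; congr pair; lia.
  + by constructor 3; lia.
- have [?|[?|?]] : c = a - 1 \/ a = c - 1 \/ c = a by lia.
  + by constructor 1; congr pair; lia.
  + by constructor 2; congr pair; lia.
  + by constructor 3; lia.
- have [?|[?|?]] : e = b + 1 \/ b = e + 1 \/ e = b by lia.
  + by constructor 1; congr pair; lia.
  + by constructor 2; congr pair; lia.
  + by constructor 3; lia.
- have [?|[?|?]] : e = b - 1 \/ b = e - 1 \/ e = b by lia.
  + by constructor 1; congr pair; lia.
  + by constructor 2; congr pair; lia.
  + by constructor 3; lia.
Qed.

Lemma mem_closed_shapeE W p q :
  ((p, q) \in sE (closed_shape W)) = [&& p \in W, q \in W & adj p q].
Proof.
rewrite /closed_shape /adj_closure /= mem_filter /= andbC andbA.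
congr andb; apply/allpairsP/andP => [[[a b] [/= ha hb [-> ->]]] //|[ha hb]].
by exists (p, q).
Qed.

(** * Collision-free linear motions *)

(** Up to the factor [q], the quantity is the gap at time [p/q] between two linear motions whose gap
    is [m] at the start and [m + e] at the end. It is a convex combination of two positive gaps. *)
Lemma linear_separation (p q : nat) (m e : int) :
  (0 < p <= q)%N -> 0 < m -> 0 < m + e -> q%:Z * m + p%:Z * e != 0.
Proof.
move=> h m0 me; suff : 0 < q%:Z * m + p%:Z * e by move/gt_eqF->.
have -> : q%:Z * m + p%:Z * e = (q%:Z - p%:Z) * m + p%:Z * (m + e) by ring.
by apply: ltr_wpDl; [apply: mulr_ge0; lia | apply: mulr_gt0; lia].
Qed.

(** The coordinate across [d] never changes, so a meeting can only occur on a common line parallel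
    to [d]. There the node behind also ends strictly behind, and [linear_separation] keeps the two
    apart in between. *)
Lemma no_meet_on_line d x y (s t : nat) : d \in dirs -> x != y ->
  (forall m, (0 < m)%N -> y = fwd d m x -> (s < m + t)%N) ->
  (forall m, (0 < m)%N -> x = fwd d m y -> (t < m + s)%N) ->
  ~ meet x (fwd d s x) y (fwd d t y).
Proof.
move=> dd nxy hxy hyx [p [q [hpq]]].
case: x y nxy hxy hyx => [a b] [c e] nxy hxy hyx.
have q0 : q%:Z != 0 by lia.
(* The one-dimensional core: [u] and [v] are starting coordinates measured along [d], so the two
   negative directions apply it to negated coordinates. *)
have key (u v : int) (s' t' : nat) :
    q%:Z * u + p%:Z * s'%:Z = q%:Z * v + p%:Z * t'%:Z ->
    (forall m : nat, (0 < m)%N -> v = u + m%:Z -> (s' < m + t')%N) ->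
    (forall m : nat, (0 < m)%N -> u = v + m%:Z -> (t' < m + s')%N) -> u = v.
  move=> E h1 h2; case: (ltgtP u v) => // huv.
  - have := h1 `|v - u|%N ltac:(lia) ltac:(lia) => h3.
    have /eqP[] := @linear_separation p q (v - u) (t'%:Z - s'%:Z) hpq
      ltac:(lia) ltac:(lia).
    by rewrite !mulrBr; lia.
  - have := h2 `|u - v|%N ltac:(lia) ltac:(lia) => h3.
    have /eqP[] := @linear_separation p q (u - v) (s'%:Z - t'%:Z) hpq
      ltac:(lia) ltac:(lia).
    by rewrite !mulrBr; lia.
have same (u v w z : int) : w = 0 -> z = 0 ->
    q%:Z * u + p%:Z * w = q%:Z * v + p%:Z * z -> u = v.
  by move=> -> ->; rewrite !mulr0 !addr0 => /(mulfI q0).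
move: hxy hyx => /[swap]; case/dirsP: dd => -> hyx hxy;
  rewrite /addp /nscale /subp /fwd /= => -[E1 E2].
- have eb : b = e by apply: same E2; lia.
  have ac : a = c.
    apply: (key _ _ s t) => [|m m0 Em|m m0 Em]; first by nia.
    + by apply: hxy => //; rewrite /fwd /addp /nscale /=; congr pair; lia.
    + by apply: hyx => //; rewrite /fwd /addp /nscale /=; congr pair; lia.
  by move: nxy; rewrite eb ac eqxx.
- have eb : b = e by apply: same E2; lia.
  have ac : - a = - c.
    apply: (key _ _ s t) => [|m m0 Em|m m0 Em]; first by nia.
    + by apply: hxy => //; rewrite /fwd /addp /nscale /=; congr pair; lia.
    + by apply: hyx => //; rewrite /fwd /addp /nscale /=; congr pair; lia.
  by move: nxy; rewrite eb (oppr_inj ac) eqxx.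
- have eb : a = c by apply: same E1; lia.
  have ac : b = e.
    apply: (key _ _ s t) => [|m m0 Em|m m0 Em]; first by nia.
    + by apply: hxy => //; rewrite /fwd /addp /nscale /=; congr pair; lia.
    + by apply: hyx => //; rewrite /fwd /addp /nscale /=; congr pair; lia.
  by move: nxy; rewrite eb ac eqxx.
- have eb : a = c by apply: same E1; lia.
  have ac : - b = - e.
    apply: (key _ _ s t) => [|m m0 Em|m m0 Em]; first by nia.
    + by apply: hxy => //; rewrite /fwd /addp /nscale /=; congr pair; lia.
    + by apply: hyx => //; rewrite /fwd /addp /nscale /=; congr pair; lia.
  by move: nxy; rewrite eb (oppr_inj ac) eqxx.
Qed.

(** * One time step from a displacement function *)

Section Step.

Variables (W W' : seq pt) (d : pt) (op : pt -> bool) (D : pt -> nat) (u0 : pt).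
Hypothesis dd : d \in dirs.
Hypothesis u0W : u0 \in W.
Hypothesis D0 : D u0 = 0%N.
Hypothesis Dorder : forall x m, x \in W -> (0 < m)%N -> fwd d m x \in W ->
  (D x + op x < m + D (fwd d m x))%N.
Hypothesis Dnext : forall x, x \in W -> fwd d 1 x \in W ->
  D (fwd d 1 x) = (D x + op x)%N.
Hypothesis Dperp : forall x y, x \in W -> y \in W -> adj x y ->
  dotp (subp y x) d = 0 -> D x = D y.
Hypothesis W'P : forall p, p \in W' <->
  exists x, x \in W /\ (p = fwd d (D x) x \/ op x /\ p = fwd d (D x).+1 x).

Let fin (a : pt * bool) :=
  if a.2 then addp (addp a.1 (nscale (D a.1) d)) d
  else addp a.1 (nscale (D a.1) d).

Let finE a : fin a = fwd d (D a.1 + a.2) a.1.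
Proof. by rewrite /fin; case: a => x []; apply: pt_eq; rewrite /= PoszD; ring. Qed.

Let extE x y : x \in W -> y \in W -> adj x y ->
  nscale (D y) d =
  addp (nscale (D x) d) (if extended op d x y then subp y x else origin).
Proof.
move=> xW yW axy.
have nfwd z : (addp (addp z d) d == z) = false.
  by apply/negbTE; case/dirsP: dd => ->; case: z => a b;
     rewrite /addp -pair_eqE /pair_eq /=; lia.
case: (adj_cases dd axy) => [Ey|Ex|dot0].
- rewrite /extended Ey eqxx andbT [x == _]eq_sym nfwd andbF orbF.
  have -> : D (addp x d) = (D x + op x)%N by rewrite -fwd1 Dnext // fwd1 -Ey.
  by case: (op x); apply: pt_eq; rewrite /= PoszD; ring.
- rewrite /extended Ex eqxx andbT [y == _]eq_sym nfwd andbF orFb.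
  have -> : D (addp y d) = (D y + op y)%N by rewrite -fwd1 Dnext // fwd1 -Ex.
  by case: (op y); apply: pt_eq; rewrite /= PoszD; ring.
- have -> : extended op d x y = false.
    apply/negbTE/negP => /orP[] /andP[_ /eqP E]; move: dot0; rewrite E;
      by case/dirsP: dd => ->; rewrite /dotp /=; lia.
  by rewrite (Dperp xW yW axy dot0); apply: pt_eq => /=; lia.
Qed.

(** All displacements are multiples [D x] of the common direction. [Dnext] and [Dperp] prescribe the
    jump of [D] across edges along and across [d], which makes the motion consistent on every cycle.
    [Dorder] keeps the nodes of a line, including the new ones, in strict order. *)
Lemma full_step_of_displacement : full_step (closed_shape W) (closed_shape W').
Proof.
pose cases (pq : pt * pt) := let: (p, q) := pq in
  [\/ exists x y, [/\ (x, y) \in sE (closed_shape W), ~~ extended op d x y,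
                      p = fin (x, false) & q = fin (y, false)],
      exists x, [/\ x \in W, op x &
          ((p = fin (x, false) /\ q = fin (x, true)) \/
           (q = fin (x, false) /\ p = fin (x, true)))] |
      exists x, [/\ x \in W, op x, (x, addp x d) \in sE (closed_shape W) &
          ((p = fin (x, true) /\ q = fin (addp x d, false)) \/
           (q = fin (x, true) /\ p = fin (addp x d, false)))]].
(* The edges prescribed by the operations form a mere proposition; excluded middle turns them into a
   list. The closure reads only the node set, so [E] need not be known further. *)
pose E := [seq pq <- [seq (p, q) | p <- W', q <- W'] |
           if excluded_middle_informative (cases pq) then true else false].
exists (Shape W' E); split; last by [].
have inF x : x \in W -> fin (x, false) \in W'.
  by move=> xW; apply/W'P; exists x; split=> //; left; rewrite finE addn0.
have inT x : x \in W -> op x -> fin (x, true) \in W'.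
  by move=> xW ox; apply/W'P; exists x; split=> //; right; rewrite finE addn1.
exists d, op, (fun x => nscale (D x) d), u0; split; split=> //.
- by rewrite /= D0; apply: pt_eq => /=; lia.
- by move=> x y /[!mem_closed_shapeE] /and3P[]; exact: extE.
- move=> a b [aW oa] [bW ob] nab.
  rewrite -/(fin a) -/(fin b) !finE.
  (* An old node and its own copy start at the same point, but [meet] concerns only positive times,
     when they have already separated. *)
  have [E1|nE] := eqVneq a.1 b.1.
    case: a b E1 nab {aW bW oa ob} => x u [y v] /= <- nuv [p [q [hpq]]].
    have {}nuv : u != v by apply: contra nuv => /eqP ->.
    rewrite /addp /nscale /subp /fwd => -[].
    by case/dirsP: dd => -> /=; case: u v nuv => [] [] //= _; nia.
  apply: no_meet_on_line => // m m0 Em.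
  - have := @Dorder a.1 m aW m0; rewrite -Em => /(_ bW).
    by case: (a.2) oa => [->|_] //; lia.
  - have := @Dorder b.1 m bW m0; rewrite -Em => /(_ aW).
    by case: (b.2) ob => [->|_] //; lia.
- move=> p; split=> [/W'P[x [xW [->|[ox ->]]]]|[[x []] [[/= xW ox] ->]]].
  + by exists (x, false); split; rewrite // -/(fin (x, false)) finE addn0.
  + by exists (x, true); split; rewrite // -/(fin (x, true)) finE addn1.
  + by rewrite -/(fin (x, true)); apply: inT => //; apply: ox.
  + by rewrite -/(fin (x, false)); apply: inF.
- move=> p q; rewrite mem_filter; split.
    by case: excluded_middle_informative.
  move=> c; have {}c : cases (p, q) by [].
  case: excluded_middle_informative => //= _.
  have [pW qW] : p \in W' /\ q \in W'.
    case: c => [[x [y [/[!mem_closed_shapeE]/and3P[xW yW _] _ -> ->]]]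
               |[x [xW ox [[-> ->]|[-> ->]]]]
               |[x [xW ox /[!mem_closed_shapeE]/and3P[_ yW _] [[-> ->]|[-> ->]]]]];
      by split; by [exact: inF | exact: inT].
  by apply/allpairsP; exists (p, q).
Qed.

End Step.

(** * Growth of closed node sets, and creation next to a static set *)

Definition grown (t : nat) (W : seq pt) : Prop :=
  grows_in single_node t (closed_shape W).

Lemma same_shape_trans S T U : same_shape S T -> same_shape T U -> same_shape S U.
Proof.
move=> [v1 e1] [v2 e2].
split=> [p|p q]; [rewrite v1; exact: v2 | rewrite e1; exact: e2].
Qed.

Lemma grown_eq t W W' : W =i W' -> grown t W -> grown t W'.
Proof.
move=> eqW; have sW : same_shape (closed_shape W) (closed_shape W').
  by split=> [p|p q]; rewrite ?mem_closed_shapeE /= !eqW.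
rewrite /grown; case: t => [|t] /=; first by move/same_shape_trans; apply.
move=> [M [gM [Se [stp sSe]]]]; exists M; split=> //; exists Se; split=> //.
exact: same_shape_trans sW.
Qed.

Lemma grown_step t W W' : full_step (closed_shape W) (closed_shape W') ->
  grown t W -> grown t.+1 W'.
Proof. by move=> stp gW; exists (closed_shape W). Qed.

(** Every operation points at a free grid point, so no edge is extended and the displacement is
    identically zero. *)
Lemma grown_add_adjacent t A R d u0 : d \in dirs -> u0 \in A ->
  (forall r, r \in R -> bwd d 1 r \in A /\ r \notin A) ->
  grown t A -> grown t.+1 (A ++ R).
Proof.
move=> dd u0A hR; apply: grown_step.
have opA x : x \in A -> fwd d 1 x \in A -> (fwd d 1 x \in R) = false.
  by move=> _ xA; apply/negP => /hR[_]; rewrite xA.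
apply: (@full_step_of_displacement _ _ d (fun x => fwd d 1 x \in R)
  (fun=> 0%N) u0) => //.
- move=> x [|[|m]] // xA _ yA; last by case: (_ \in R).
  by rewrite opA.
- by move=> x xA yA; rewrite opA.
- move=> p; rewrite mem_cat; split.
  + case/orP => [pA|/[dup] pR /hR[bA _]].
      by exists p; split=> //; left; rewrite fwd0.
    by exists (bwd d 1 p); split=> //; right; rewrite fwd_bwd // subnn bwd0.
  + by case=> x [xA [->|[xR ->]]]; rewrite ?fwd0 ?xA // xR orbT.
Qed.

(** * Simultaneous doubling of isolated segments *)

Section Doubling.

(* Above each [a \in A] stands a segment [fwd d i a], [0 < i <= len a], that
   touches the rest of the configuration only along its own line. *)
Variables (A : seq pt) (len : pt -> nat) (d u0 : pt) (N : nat).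
Hypothesis dd : d \in dirs.
Hypothesis u0A : u0 \in A.
Hypothesis lenN : forall a, (len a <= N)%N.
Hypothesis segA : forall a i, a \in A -> (0 < i <= len a)%N -> fwd d i a \notin A.
Hypothesis seg_free : forall a b i j, a \in A -> b \in A ->
  (0 < i <= len a)%N -> (j <= len b)%N ->
  adj (fwd d i a) (fwd d j b) ->
  dotp (subp (fwd d j b) (fwd d i a)) d <> 0.

Definition truncated (h : nat) : seq pt :=
  [seq fwd d i a | a <- A, i <- iota 0 (minn h (len a).+1)].

Lemma truncatedP h p : reflect
  (exists a i, [/\ a \in A, (i < h)%N, (i <= len a)%N & p = fwd d i a])
  (p \in truncated h).
Proof.
apply: (iffP allpairsPdep) => [[a [i [aA]]]|[a [i [aA ih il ->]]]].
  by rewrite mem_iota /= add0n leq_min ltnS => /andP[ih il] ->; exists a, i.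
by exists a, i; split=> //; rewrite mem_iota /= add0n leq_min ih.
Qed.

Let idx x := find (fun j => bwd d j x \in A) (iota 0 N.+1).

(** By [segA], walking back from a point of a segment meets [A] for the first time at the foot; thus
    a point determines its height and its foot. *)
Let idxE a i : a \in A -> (i <= len a)%N -> idx (fwd d i a) = i.
Proof.
move=> aA il; have iN : (i < N.+1)%N by rewrite ltnS (leq_trans il).
have hi : bwd d i (fwd d i a) \in A by rewrite bwd_fwd // subnn fwd0.
apply/eqP; rewrite eqn_leq; apply/andP; split; rewrite leqNgt; apply/negP => hlt.
  have := before_find 0%N hlt; rewrite nth_iota // add0n => /negP; exact.
have := @nth_find _ 0%N (fun j => bwd d j (fwd d i a) \in A) (iota 0 N.+1).
rewrite -/(idx _) has_find size_iota -/(idx _) (ltn_trans hlt iN) => /(_ isT).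
rewrite nth_iota ?(ltn_trans hlt iN) // add0n bwd_fwd; last exact: ltnW.
by apply/negP; apply: segA => //; lia.
Qed.

Let root x := bwd d (idx x) x.

Let rootE a i : a \in A -> (i <= len a)%N -> root (fwd d i a) = a.
Proof. by move=> aA il; rewrite /root idxE // bwd_fwd // subnn fwd0. Qed.

(* With [h] of the [L = len a + 1] nodes present, the lowest [L - h] of them
   are doubled. *)
Lemma full_step_doubling h : (0 < h)%N ->
  full_step (closed_shape (truncated h)) (closed_shape (truncated (h + h))).
Proof.
move=> h0.
pose gap x := ((len (root x)).+1 - h)%N.
pose op x := (idx x < gap x)%N.
(* The operating nodes on a segment are those of height below [gap x]; [D x] counts the ones below
   [x], each of which pushes [x] by one unit. *)
pose D x := minn (idx x) (gap x).
have gapE a i : a \in A -> (i <= len a)%N -> gap (fwd d i a) = ((len a).+1 - h)%N.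
  by move=> aA il; rewrite /gap rootE.
have opE a i : a \in A -> (i <= len a)%N ->
    op (fwd d i a) = (i < (len a).+1 - h)%N.
  by move=> aA il; rewrite /op idxE // gapE.
have DE a i : a \in A -> (i <= len a)%N ->
    D (fwd d i a) = minn i ((len a).+1 - h).
  by move=> aA il; rewrite /D idxE // gapE.
apply: (@full_step_of_displacement _ _ d op D u0) => //.
- by apply/truncatedP; exists u0, 0%N; rewrite fwd0.
- by rewrite -[u0](fwd0 d) DE // min0n.
- move=> x m /truncatedP[a [i [aA ih il ->]]] m0 _.
  rewrite fwdD (DE a i) // (opE a i) //.
  have [im|im] := leqP (i + m) (len a); last by lia.
  by rewrite DE //; lia.
- move=> x /truncatedP[a [i [aA ih il ->]]]; rewrite fwdD addn1 (DE a i) // (opE a i) //.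
  have [im|im] := ltnP i (len a); first by rewrite DE // => _; lia.
  (* Here [i] is the tip of a complete segment, so its gap is zero. The next point can only be a
     foot, which does not move: a positive height would put it on the same segment, beyond its
     tip. *)
  case/truncatedP=> b [[|j] [bA jh jl E]]; rewrite E DE //; first by lia.
  have E' : fwd d i a = fwd d j b.
    move: (congr1 (bwd d 1) E).
    by rewrite !bwd_fwd // !subn1.
  have ij : i = j by rewrite -(idxE aA il) E' idxE //; lia.
  have ab : a = b by rewrite -(rootE aA il) E' rootE //; lia.
  by move: jl; rewrite -ab -ij; lia.
- move=> x y /truncatedP[a [i [aA ih il ->]]] /truncatedP[b [j [bA jh jl ->]]].
  case: (posnP i) => [->|i0] ad dot0; last first.
    by case: (@seg_free a b i j) => //; rewrite i0.
  case: (posnP j) ad dot0 => [->|j0] ad dot0; first by rewrite !DE // !min0n.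
  case: (@seg_free b a j 0) => //; rewrite ?j0 //.
    by move: ad; rewrite /adj distrC [in X in _ + X]distrC.
  by move: dot0; rewrite /dotp /=; lia.
- move=> p; split.
  + case/truncatedP=> a [k [aA kh kl ->]].
    (* In the doubled range, final height [k] comes from the node at height [k./2], as its copy if
       [k] is odd. Above that range, nodes are only shifted by the gap. *)
    have [k2|k2] := ltnP k ((len a).+1 - h).*2.
      exists (fwd d k./2 a); split.
        by apply/truncatedP; exists a, k./2; split=> //; lia.
      rewrite DE ?opE //; try lia.
      rewrite !fwdD; case ok : (odd k); [right|left]; [split|]; try lia.
        by congr fwd; lia.
      by congr fwd; lia.
    exists (fwd d (k - ((len a).+1 - h)) a); split.
      by apply/truncatedP; exists a, (k - ((len a).+1 - h))%N; split=> //; lia.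
    by left; rewrite DE ?fwdD; try lia; congr fwd; lia.
  + case=> x [/truncatedP[a [i [aA ih il ->]]]].
    rewrite DE // opE // !fwdD => -[->|[oi ->]]; apply/truncatedP.
      by exists a, (i + minn i ((len a).+1 - h))%N; split=> //; lia.
    by exists a, (i + (minn i ((len a).+1 - h)).+1)%N; split=> //; lia.
Qed.

Lemma grown_doubling t T : grown t A -> grown (t + T) (truncated (2 ^ T)).
Proof.
move=> gA; elim: T => [|T IH].
  rewrite addn0; apply: grown_eq gA => p; apply/idP/truncatedP.
    by move=> pA; exists p, 0%N; rewrite fwd0.
  by case=> a [[|i] [aA // _ _ ->]]; rewrite fwd0.
rewrite addnS; apply: grown_step IH.
by rewrite expnS mul2n -addnn; apply: full_step_doubling; rewrite expn_gt0.
Qed.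

End Doubling.

(** * Hanging segments and parity of lines *)

Definition hangs (A P : seq pt) (d p : pt) : Prop :=
  exists i, [/\ (0 < i)%N, bwd d i p \in A & forall j, (j < i)%N -> bwd d j p \in P].

(** A coordinate swap rather than a rotation; it sends each cardinal direction to an orthogonal
    one. *)
Definition perp (d : pt) : pt := (d.2, d.1).

Lemma perp_dirs d : d \in dirs -> perp d \in dirs.
Proof. by case/dirsP=> ->. Qed.

Definition oppp (d : pt) : pt := (- d.1, - d.2).

Lemma oppp_dirs d : d \in dirs -> oppp d \in dirs.
Proof. by case/dirsP=> ->. Qed.

(** The coordinate across [d] modulo 2: constant on each line parallel to [d], different on
    neighbouring lines. *)
Definition line_parity (d p : pt) : bool := (2 %| dotp p (perp d))%Z.

Lemma line_parity_bwd d j p : d \in dirs ->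
  line_parity d (bwd d j p) = line_parity d p.
Proof.
by case/dirsP=> ->; rewrite /line_parity /dotp /=; congr (_ %| _)%Z; lia.
Qed.

Lemma adj_perpE d x y : d \in dirs -> adj x y -> dotp (subp y x) d = 0 ->
  y = bwd (perp d) 1 x \/ y = bwd (oppp (perp d)) 1 x.
Proof.
case: x y => [a b] [c e] dd; rewrite /adj /dotp /bwd /subp /nscale.
case/dirsP: dd => -> /= h h0.
- have [?|?] : e = b - 1 \/ e = b + 1 by lia.
  + by left; congr pair; lia.
  + by right; congr pair; lia.
- have [?|?] : e = b - 1 \/ e = b + 1 by lia.
  + by right; congr pair; lia.
  + by left; congr pair; lia.
- have [?|?] : c = a - 1 \/ c = a + 1 by lia.
  + by left; congr pair; lia.
  + by right; congr pair; lia.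
- have [?|?] : c = a - 1 \/ c = a + 1 by lia.
  + by right; congr pair; lia.
  + by left; congr pair; lia.
Qed.

Lemma line_parity_perp d x y : d \in dirs -> adj x y ->
  dotp (subp y x) d = 0 -> line_parity d y = ~~ line_parity d x.
Proof.
move=> dd ad /(adj_perpE dd ad) [] ->; rewrite /line_parity /dotp;
  by case/dirsP: dd => -> /=; lia.
Qed.

(** * Adding all segments of one direction *)

Section Stage.

Variables (V : seq pt) (T : nat) (u0 : pt).
Hypothesis VT : (size (undup V) < 2 ^ T)%N.

(** The runs of [Q] above the points of [A] have fewer than [2 ^ T] nodes, so [T] rounds of doubling
    complete all of them. *)
Lemma grown_add_isolated t A Q d : d \in dirs -> u0 \in A ->
  {subset Q <= V} ->
  (forall q, q \in Q -> hangs A Q d q) ->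
  (forall q, q \in Q -> q \notin A) ->
  (forall x y, x \in Q -> y \in A ++ Q -> adj x y -> dotp (subp y x) d <> 0) ->
  grown t A -> grown (t + T) (A ++ Q).
Proof.
move=> dd u0A QV hQ QA free gA.
set N := size (undup V).
pose len a := find (fun m => fwd d m.+1 a \notin Q) (iota 0 N).
have lenN a : (len a <= N)%N by rewrite -[leqRHS](size_iota 0) find_size.
have lenQ a i : (0 < i <= len a)%N -> fwd d i a \in Q.
  case: i => // i /= il.
  have := before_find 0%N il; rewrite nth_iota ?add0n; last first.
    exact: leq_trans il (lenN a).
  by move/negbFE.
have lenAQ a i : a \in A -> (i <= len a)%N -> fwd d i a \in A ++ Q.
  case: i => [|i] aA il; rewrite mem_cat ?fwd0 ?aA //.
  by rewrite lenQ ?orbT.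
apply: (@grown_eq _ (truncated A len d (2 ^ T))); last first.
  apply: (@grown_doubling A len d u0 N) => //.
    by move=> a i aA il; apply/QA/lenQ.
  move=> a b i j aA bA il jl; apply: free; [exact: lenQ | exact: lenAQ].
move=> p; apply/truncatedP/idP => [[a [i [aA _ il ->]]]|]; first exact: lenAQ.
rewrite mem_cat => /orP[pA|/hQ[i [i0 iA iQ]]].
  by exists p, 0%N; rewrite fwd0 expn_gt0.
(* The [i] points from [p] back to just above its foot are distinct members of [V]. *)
have iN : (i <= N)%N.
  rewrite -(size_iota 0 i) -(size_map (fun j => bwd d j p)).
  apply: uniq_leq_size; first by rewrite map_inj_uniq ?iota_uniq //; exact: bwd_inj.
  by move=> x /mapP[j]; rewrite mem_iota mem_undup => /andP[_ ji] ->; apply/QV/iQ.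
exists (bwd d i p), i; split=> //.
- exact: leq_ltn_trans iN VT.
- rewrite leqNgt; apply/negP => hlt.
  have := @nth_find _ 0%N (fun m => fwd d m.+1 (bwd d i p) \notin Q) (iota 0 N).
  rewrite has_find size_iota -/(len _) (leq_trans hlt iN) => /(_ isT).
  rewrite nth_iota ?add0n ?(leq_trans hlt iN) // fwd_bwd // iQ //.
  by lia.
- by rewrite fwd_bwd // subnn bwd0.
Qed.

(** [R1] and [R2] absorb the points with a sideways neighbour in [A], one step for each side. The
    remainder [Q] is isolated sideways: a neighbour in [A] would have placed the point in [R1] or
    [R2], and a neighbour in [P] would have the other parity. *)
Lemma grown_add_parity t A P d b : d \in dirs -> u0 \in A -> {subset P <= V} ->
  (forall p, p \in P -> line_parity d p = b) ->
  (forall p, p \in P -> hangs A P d p) ->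
  grown t A -> grown (t + T.+2) (A ++ P).
Proof.
move=> dd u0A PV Pb hP gA.
set e := perp d; have ee : e \in dirs by exact: perp_dirs.
have e'e : oppp e \in dirs by exact: oppp_dirs.
pose R1 := [seq p <- P | (p \notin A) && (bwd e 1 p \in A)].
pose R2 := [seq p <- P | (p \notin A ++ R1) && (bwd (oppp e) 1 p \in A)].
pose Q := [seq p <- P | p \notin (A ++ R1) ++ R2].
have g1 : grown t.+1 (A ++ R1).
  apply: (@grown_add_adjacent _ _ _ e u0) => // r.
  by rewrite mem_filter => /andP[/andP[-> ->]].
have g2 : grown t.+2 ((A ++ R1) ++ R2).
  apply: (@grown_add_adjacent _ _ _ (oppp e) u0) => //; first by rewrite mem_cat u0A.
  move=> r; rewrite mem_filter => /andP[/andP[-> rA] _]; split=> //.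
  by rewrite mem_cat rA.
have subP : {subset ((A ++ R1) ++ R2) ++ Q <= A ++ P}.
  move=> p; rewrite !mem_cat !mem_filter.
  by case: (p \in A) (p \in P) => [] [] //=; rewrite ?andbF.
apply: (@grown_eq _ (((A ++ R1) ++ R2) ++ Q)).
  move=> p; apply/idP/idP; first exact: subP.
  move=> pAP; rewrite mem_cat [p \in Q]mem_filter.
  have [//|] := boolP (p \in (A ++ R1) ++ R2).
  by move: pAP; rewrite !mem_cat => /orP[->|->].
rewrite -(addSnnS t) -(addSnnS t.+1).
apply: (@grown_add_isolated _ _ _ d) g2 => //.
- by rewrite !mem_cat u0A.
- by move=> q; rewrite mem_filter => /andP[_ /PV].
- move=> q; rewrite mem_filter => /andP[qn qP].
  have [i [i0 iA iP]] := hP _ qP.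
  (* The side steps may have filled part of the segment, so the foot becomes the nearest occupied
     point behind [q]. *)
  have ex : exists i, bwd d i q \in (A ++ R1) ++ R2 by exists i; rewrite !mem_cat iA.
  case: (ex_minnP ex) => m mA mmin; exists m; split=> //.
    by case: m mA {mmin} => //; rewrite bwd0 (negbTE qn).
  move=> j jm; rewrite mem_filter; apply/andP; split.
    by apply/negP => /mmin; rewrite leqNgt jm.
  by apply: iP; apply: leq_trans jm _; apply: mmin; rewrite !mem_cat iA.
- by move=> q; rewrite mem_filter => /andP[].
- move=> x y; rewrite mem_filter => /andP[xn xP] yA ad dot0.
  have {yA} : y \in A.
    move/subP: yA; rewrite mem_cat => /orP[//|yP].
    by have := line_parity_perp dd ad dot0; rewrite !Pb //; case: (b).
  case: (adj_perpE dd ad dot0) => -> yA.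
  + by move: xn; rewrite !mem_cat !mem_filter yA xP; case: (x \in A).
  + by move: xn; rewrite !mem_cat !mem_filter yA xP !mem_cat !mem_filter;
       do 2 case: (_ \in A).
Qed.

(** A segment stays on its line, hence in one parity class; the two classes are added one after the
    other. *)
Lemma grown_add_segments t A P d : d \in dirs -> u0 \in A -> {subset P <= V} ->
  (forall p, p \in P -> hangs A P d p) ->
  grown t A -> grown (t + T.+2.*2) (A ++ P).
Proof.
move=> dd u0A PV hP gA.
pose Pb b := [seq p <- P | line_parity d p == b].
have hPb b p : p \in Pb b -> hangs A (Pb b) d p.
  rewrite mem_filter => /andP[pb /hP[i [i0 iA iP]]].
  exists i; split=> // j ji.
  by rewrite mem_filter line_parity_bwd // pb iP.
have PbV b : {subset Pb b <= V} by move=> p; rewrite mem_filter => /andP[_ /PV].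
have par b p : p \in Pb b -> line_parity d p = b.
  by rewrite mem_filter => /andP[/eqP].
have g1 := grown_add_parity dd u0A (PbV true) (@par true) (@hPb true) gA.
have u0A1 : u0 \in A ++ Pb true by rewrite mem_cat u0A.
have h2 p : p \in Pb false -> hangs (A ++ Pb true) (Pb false) d p.
  by move/hPb => [i [i0 iA iP]]; exists i; rewrite mem_cat iA.
have := grown_add_parity dd u0A1 (PbV false) (@par false) h2 g1.
rewrite -addnA addnn; apply: grown_eq => p.
rewrite !mem_cat !mem_filter.
by case: (p \in A) (p \in P) (line_parity d p) => [] [] [].
Qed.

End Stage.

(** * Levels of the spanning tree by number of turns *)

Section Levels.

Variables (k : nat) (V : seq pt) (par : pt -> pt).
Local Notation r := origin.
Hypothesis rV : r \in V.
Hypothesis parV : forall v, v \in V -> v != r -> par v \in V /\ adj (par v) v.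
Hypothesis reach : forall v, v \in V -> exists m, iter m par v = r.
Hypothesis leaf_turns : forall v, v \in V ->
  (forall u, u \in V -> u != r -> par u != v) ->
  forall m, iter m par v = r -> r \notin traject par v m ->
  (turns (traject par v m.+1) <= k)%N.

(** The implication makes the statement hold at every point, so that [ex_minn] gives a total depth
    function, with value 0 outside [V]. *)
Let reachb v : exists m, (v \in V) ==> (iter m par v == r).
Proof.
have [/reach[m E]|_] := boolP (v \in V); last by exists 0%N.
by exists m; rewrite E eqxx.
Qed.

Let dep v := ex_minn (reachb v).
Let tau v := turns (traject par v (dep v).+1).

Let iter_dep v : v \in V -> iter (dep v) par v = r.
Proof. by move=> vV; rewrite /dep; case: ex_minnP => m; rewrite vV => /eqP. Qed.

Let dep_min v m : v \in V -> iter m par v = r -> (dep v <= m)%N.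
Proof.
move=> vV E; rewrite /dep; case: ex_minnP => n _; apply.
by rewrite vV E eqxx.
Qed.

Let dep0 : dep r = 0%N.
Proof. by apply/eqP; rewrite -leqn0 dep_min. Qed.

Let depS v : v \in V -> v != r -> dep v = (dep (par v)).+1.
Proof.
move=> vV vr; have [pV _] := parV vV vr.
apply/eqP; rewrite eqn_leq; apply/andP; split.
  by apply: dep_min => //; rewrite iterSr iter_dep.
have := iter_dep vV; case E : (dep v) => [|m]; first by move/eqP; rewrite (negbTE vr).
by rewrite iterSr ltnS; apply: dep_min.
Qed.

Let r_notin_path v : v \in V -> r \notin traject par v (dep v).
Proof.
move=> vV; apply/negP => /trajectP[i hi /esym /(dep_min vV)].
by rewrite leqNgt hi.
Qed.

Let tau_r : tau r = 0%N.
Proof. by rewrite /tau dep0. Qed.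

Let tau_par v : v \in V -> v != r -> par v != r ->
  tau v = ((dotp (subp (par v) v) (subp (par (par v)) (par v)) == 0)
           + tau (par v))%N.
Proof.
move=> vV vr pr; have [pV _] := parV vV vr.
by rewrite /tau depS // depS.
Qed.

Let tau_par_le v : v \in V -> v != r -> (tau (par v) <= tau v)%N.
Proof.
move=> vV vr; have [->|pr] := eqVneq (par v) r; first by rewrite tau_r.
by rewrite (tau_par vV vr pr) leq_addl.
Qed.

(* A node of maximal depth is a leaf, so descending induction on the depth
   extends the bound from leaves to all nodes. *)
Let tau_le v : v \in V -> (tau v <= k)%N.
Proof.
pose M := \max_(u <- V) dep u.
have depM u : u \in V -> (dep u <= M)%N by move=> uV; apply: leq_bigmax_seq.
have [n] := ubnP (M - dep v); elim: n v => // n IH v hn vV.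
have [/hasP[u uV /andP[ur /eqP pu]]|/hasPn nch] :=
    boolP (has (fun u => (u != r) && (par u == v)) V).
  rewrite -pu; apply: leq_trans (tau_par_le uV ur) _; apply: IH => //.
  have := depM _ uV; have := depS uV ur; rewrite pu; lia.
apply: leaf_turns; rewrite ?iter_dep ?r_notin_path // => u uV ur.
by have := nch u uV; rewrite ur.
Qed.

Let level i := [seq v <- V | (v == r) || (tau v < i)%N].
Let branch i d := [seq v <- V | [&& v != r, (tau v <= i)%N & v == addp (par v) d]].

(** If the parent of [v] is outside [level i], it already has [i] turns, so the path does not turn
    there. It does not reverse either, as depth decreases strictly towards the root. The parent is
    therefore entered along [d] as well, and induction on depth applies. *)
Let branch_hangs i d A v : d \in dirs -> {subset level i <= A} ->
  v \in branch i d -> hangs A (branch i d) d v.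
Proof.
move=> dd lA; have [n] := ubnP (dep v); elim: n v => // n IH v hn vB.
move: (vB); rewrite mem_filter => /andP[/and3P[vr ti /eqP vE] vV].
have [pV _] := parV vV vr.
have pE : par v = bwd d 1 v by rewrite {2}vE; apply: pt_eq => /=; lia.
have [pl|pl] := boolP (par v \in level i).
  exists 1%N; split=> //; first by rewrite -pE; apply: lA.
  by case=> // _; rewrite bwd0.
have pB : par v \in branch i d.
  move: pl; rewrite mem_filter pV andbT negb_or -leqNgt => /andP[pr it].
  rewrite mem_filter pV pr (leq_trans (tau_par_le vV vr) ti) andbT /=.
  have [ppV pad] := parV pV pr.
  have /eqP dot1 : dotp (subp (par v) v) (subp (par (par v)) (par v)) != 0.
    move: ti; rewrite (tau_par vV vr pr); case: eqP => //= _.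
    by rewrite add1n ltnNge it.
  case: (adj_cases dd pad) => [E|E|dot0]; first by rewrite -E.
    have : dep (par (par v)) = dep v by rewrite E -vE.
    by rewrite (depS vV vr) (depS pV pr); lia.
  case: dot1; rewrite -[RHS]dot0 [X in subp _ X]vE /dotp /=; ring.
have [|j [j0 jA jB]] := IH (par v) _ pB; first by move: hn; rewrite (depS vV vr).
exists j.+1; split=> //; first by move: jA; rewrite pE bwdD add1n.
by case=> [|m] hm; [rewrite bwd0 | have := jB m hm; rewrite pE bwdD add1n].
Qed.

Let level_split i : level i.+1 =i
  (((level i ++ branch i (1, 0)) ++ branch i (-1, 0)) ++ branch i (0, 1))
    ++ branch i (0, -1).
Proof.
move=> v; rewrite !mem_cat !mem_filter.
have [vV|_] := boolP (v \in V); rewrite ?andbF // !andbT.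
have [->|vr] //= := eqVneq v r.
rewrite ltnS; have [ti|ti] := leqP (tau v) i; last first.
  by rewrite /= !orbF; apply/esym/negbTE; rewrite -leqNgt ltnW.
have [_] := parV vV vr; rewrite /= /adj => ad.
have : [|| v == addp (par v) (1, 0), v == addp (par v) (-1, 0),
           v == addp (par v) (0, 1) | v == addp (par v) (0, -1)].
  case: v (par v) {vV vr ti} ad => [a b] [c e]; rewrite /addp -!pair_eqE /pair_eq /=.
  by lia.
by case/or4P=> ->; rewrite ?orbT.
Qed.

(** A level costs four directions times two parities times [T.+2] steps; turn counts from 0 to [k]
    give [k.+1] levels. *)
Lemma grown_tree T : (size (undup V) < 2 ^ T)%N ->
  grown (k.+1 * (8 * T.+2)) V.
Proof.
move=> VT.
have bV i d : {subset branch i d <= V} by move=> v; rewrite mem_filter => /andP[].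
have r_level i : r \in level i by rewrite mem_filter eqxx.
have gl i : grown (i * (8 * T.+2)) (level i).
  elim: i => [|i IH].
    split=> [p|p q]; last first.
      rewrite mem_closed_shapeE !mem_filter !orbF /=; split=> //.
      by case/and3P => /andP[/eqP-> _] /andP[/eqP-> _].
    rewrite /= mem_filter orbF inE; split=> [/eqP->|/andP[]//].
    by rewrite eqxx.
  have add t A d : d \in dirs -> {subset level i <= A} -> grown t A ->
      {subset level i <= A ++ branch i d} /\ grown (t + T.+2.*2) (A ++ branch i d).
    move=> dd lA gA; split; first by move=> p /lA pA; rewrite mem_cat pA.
    apply: (@grown_add_segments V T r VT _ _ _ d) gA => //; first exact: lA.
    by move=> p; apply: branch_hangs.
  have [s1 g1] := @add _ _ (1, 0) isT (fun p => id) IH.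
  have [s2 g2] := @add _ _ (-1, 0) isT s1 g1.
  have [s3 g3] := @add _ _ (0, 1) isT s2 g2.
  have [s4 g4] := @add _ _ (0, -1) isT s3 g3.
  apply: (@grown_eq _ _ _ (fsym (level_split i))).
  by move: g4; congr grown; lia.
apply: grown_eq (gl k.+1) => v; rewrite mem_filter.
by have [/tau_le tk|_] := boolP (v \in V); rewrite ?andbF // ltnS tk orbT.
Qed.

End Levels.

(** * Translation of the root to the origin, and conclusion *)

Definition recenter (r p : pt) : pt := subp p r.

Lemma recenterK r : cancel (recenter r) (addp^~ r).
Proof. by move=> p; apply: pt_eq => /=; lia. Qed.

Lemma addpK r : cancel (addp^~ r) (recenter r).
Proof. by move=> p; apply: pt_eq => /=; lia. Qed.

Lemma mem_recenter r V p : (p \in map (recenter r) V) = (addp p r \in V).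
Proof.
by rewrite -{1}[p](addpK r) mem_map //; exact: can_inj (recenterK r).
Qed.

Lemma adj_addp r p q : adj (addp p r) (addp q r) = adj p q.
Proof. by rewrite /adj /=; lia. Qed.

Lemma turns_addp r s : turns (map (addp^~ r) s) = turns s.
Proof.
elim: s => // a [//|b [//|c s]] IH.
have E : subp (addp b r) (addp a r) = subp b a by apply: pt_eq => /=; lia.
have E' : subp (addp c r) (addp b r) = subp c b by apply: pt_eq => /=; lia.
have -> : turns [:: a, b, c & s] =
  ((dotp (subp b a) (subp c b) == 0) + turns [:: b, c & s])%N by [].
by rewrite -IH -E -E'.
Qed.

Local Close Scope ring_scope.

Theorem theorem4p1 :
  exists c : nat, forall (k : nat) (S : gshape),
    is_shape S -> in_Ck k S ->
    exists (t : nat) (T : gshape),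
      (t <= c * k.+1 * (trunc_log 2 (nnodes S)).+1)%N /\
      grows_in single_node t T /\ transl_eq T (adj_closure S).
Proof.
(* With [T = L.+1], a level takes [8 * L.+3] steps, at most [24 * L.+1]. *)
exists 24 => k S [_ edgeS _ _] [r [par [rV parV reach leaf]]].
set L := trunc_log 2 (nnodes S).
pose V := map (recenter r) (sV S).
pose par' p := recenter r (par (addp p r)).
have iterE m v : addp (iter m par' v) r = iter m par (addp v r).
  by elim: m => //= m <-; rewrite recenterK.
have trajE m v : map (addp^~ r) (traject par' v m) = traject par (addp v r) m.
  by elim: m v => //= m IH v; rewrite IH recenterK.
have r0 : addp origin r = r by apply: pt_eq => /=; lia.
have rE p : (addp p r == r) = (p == origin).
  by rewrite -{2}r0 (inj_eq (can_inj (addpK r))).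
exists (k.+1 * (8 * L.+3)), (closed_shape V); split; first by nia.
split; last first.
  exists r; split=> [p|p q]; first by rewrite mem_recenter.
  rewrite mem_closed_shapeE !mem_recenter.
  by rewrite -[adj_closure S]/(closed_shape (sV S)) mem_closed_shapeE adj_addp.
apply: (@grown_tree k V par' _ _ _ _ L.+1).
- by rewrite mem_recenter r0.
- move=> v; rewrite !mem_recenter -rE => vV vr.
  have [pV pE] := parV _ vV vr.
  rewrite recenterK; split=> //; rewrite -(adj_addp r) recenterK.
  by have [] := edgeS _ _ pE.
- move=> v; rewrite mem_recenter => /reach[m E]; exists m.
  by apply/eqP; rewrite -rE iterE E.
- move=> v; rewrite mem_recenter => vV nch m E rn.
  rewrite -(turns_addp r) trajE; apply: leaf => //.
  + move=> u uV ur.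
    have := nch (recenter r u); rewrite mem_recenter recenterK -rE recenterK.
    move=> /(_ uV ur); apply: contra => /eqP pu.
    by rewrite /par' recenterK pu addpK.
  + by rewrite -iterE E r0.
  + rewrite -trajE; apply: contra rn => /mapP[x xt /esym /eqP].
    by rewrite rE => /eqP <-.
- rewrite undup_map_inj; last exact: can_inj (recenterK r).
  by rewrite size_map; apply: trunc_log_ltn.
Qed.
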